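(* For every $n\in\mathbb{N}$, the tuple $(\mathbb{Q}_{n,\boxtimes},\oplus_{n,\boxtimes},\otimes_{n,\boxtimes})$ is a commutative field.
   Context: $\mathbb{N}=\{0,1,2,\dots\}$ with successor function $S$ and its inverse $S^{-1}$. The hyperoperations $H_n:\mathbb{N}^2\to\mathbb{N}$ are: $H_0(a,b)=S(b)$; $H_1(a,0)=a$; $H_2(a,0)=0$; $H_n(a,0)=1$ for $n\ge 3$; and $H_n(a,b)=H_{n-1}(a,H_n(a,S^{-1}(b)))$ for $n\geq 1$, $b\neq 0$ (so $H_1,H_2,H_3$ are addition, multiplication, exponentiation). Fix $w_0\in\mathbb{N}\setminus\{0,1\}$, let $E:\mathbb{N}\to\mathbb{N}$, $E(a)=H_3(w_0,a)$, and let $L$ be its inverse on $E(\mathbb{N})$. Put $\stackrel{0}{\mathbb{N}}=\mathbb{N}$, $\stackrel{n+1}{\mathbb{N}}=E(\stackrel{n}{\mathbb{N}})$; one has $\stackrel{n+1}{\mathbb{N}}\subset\stackrel{n}{\mathbb{N}}$. Write $\stackrel{n}{\mathbb{N}}=\{\stackrel{n}{0},\stackrel{n}{1},\stackrel{n}{2},\dots\}$ where $\stackrel{0}{k}=k$ and $\stackrel{n+1}{k}=E(\stackrel{n}{k})$. Commutative hyperoperations: $F_0=H_1$, $F_1=H_2$ on $\mathbb{N}$; for $n\ge 2$, $F_n:(\stackrel{n-1}{\mathbb{N}})^2\to\stackrel{n-1}{\mathbb{N}}$ is $F_n(a,b)=E(F_{n-1}(L(a),L(b)))$. On $\stackrel{n}{\mathbb{N}}\subset\stackrel{n-1}{\mathbb{N}}$,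 $F_n$ denotes its restriction. Integers of level $n$: on $\stackrel{n}{\mathbb{N}}\times\stackrel{n}{\mathbb{N}}$ define $(x,y)\oplus_n(u,v)=(F_n(x,u),F_n(y,v))$ and $(x,y)\otimes_n(u,v)=(F_n(F_{n+1}(x,u),F_{n+1}(y,v)),\,F_n(F_{n+1}(y,u),F_{n+1}(x,v)))$, and the congruence $(x,y)\stackrel{n}{\square}(u,v)\iff F_n(x,v)=F_n(y,u)$. Let $\mathbb{Z}_{n,\square}=(\stackrel{n}{\mathbb{N}}\times\stackrel{n}{\mathbb{N}})/\!\stackrel{n}{\square}$, with classes $[\![(x,y)]\!]_{n,\square}$ and induced operations $\oplus_{n,\square}$, $\otimes_{n,\square}$. Put $k_{n,\square}=[\![(\stackrel{n}{k},\stackrel{n}{0})]\!]_{n,\square}$ and $\mathbb{Z}_{n,\square}^{\ast}=\mathbb{Z}_{n,\square}\setminus\{0_{n,\square}\}$. Quotients of level $n$: on $\mathbb{Z}_{n,\square}\times\mathbb{Z}_{n,\square}^{\ast}$ define $(x,y)\otimes'_n(u,v)=(x\otimes_{n,\square}u,\,y\otimes_{n,\square}v)$, $(x,y)\oplus'_n(u,v)=((x\otimes_{n,\square}v)\oplus_{n,\square}(y\otimes_{n,\square}u),\,y\otimes_{n,\square}v)$, and the congruence $(x,y)\stackrel{n}{\boxtimes}(u,v)\iff x\otimes_{n,\square}v=u\otimes_{n,\square}y$. Then $\mathbb{Q}_{n,\boxtimes}=(\mathbb{Z}_{n,\square}\times\mathbb{Z}_{n,\square}^{\ast})/\!\stackrel{n}{\boxtimes}$,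 and $\oplus_{n,\boxtimes}$, $\otimes_{n,\boxtimes}$ are the operations induced on it by $\oplus'_n$, $\otimes'_n$ (addition and multiplication respectively). *)

(* Defs.v *)
(* MathComp, with classical sets from mathcomp-classical. *)
From HB Require Import structures.
From mathcomp Require Import all_boot all_order all_algebra.
From mathcomp Require Import ring zify.
From mathcomp Require Import boolp classical_sets.

Set Implicit Arguments.
Unset Strict Implicit.
Unset Printing Implicit Defensive.

Import Order.TTheory GRing.Theory Num.Theory.

Local Open Scope nat_scope.
Local Open Scope quotient_scope.
Local Open Scope classical_set_scope.

(* Value of the hyperoperation of index n >= 1 at (a, 0). *)
Definition hyper0 (n a : nat) : nat :=
  match n with 1 => a | 2 => 0 | _ => 1 end.

Fixpoint hyper (n : nat) : nat -> nat -> nat :=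
  match n with
  | 0 => fun _ b => b.+1
  | m.+1 => fun a => fix hyperS b :=
      match b with
      | 0 => hyper0 m.+1 a
      | b'.+1 => hyper m a (hyperS b')
      end
  end.

Lemma hyper1 : hyper 1 =2 addn.
Proof. by move=> a; elim=> [|b IH] /=; rewrite ?addn0 // addnS -IH. Qed.

Lemma hyper2 : hyper 2 =2 muln.
Proof.
move=> a; elim=> [|b IH]; first by rewrite muln0.
by rewrite -[LHS]/(hyper 1 a (hyper 2 a b)) hyper1 IH mulnS.
Qed.

Lemma hyper3 : hyper 3 =2 expn.
Proof.
move=> a; elim=> [|b IH] //.
by rewrite -[LHS]/(hyper 2 a (hyper 3 a b)) hyper2 IH expnS.
Qed.

Definition E (w0 a : nat) : nat := hyper 3 w0 a.

(* The inverse of E on its range; it takes the junk value 0 elsewhere. *)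
Definition L (w0 a : nat) : nat := xget 0 [set b | E w0 b = a].

Fixpoint level (w0 n : nat) : set nat :=
  if n is m.+1 then E w0 @` level w0 m else setT.

Fixpoint num (w0 n k : nat) : nat :=
  if n is m.+1 then E w0 (num w0 m k) else k.

(* For n >= 2 only the values of F n on level n.-1 are meaningful. *)
Fixpoint F (w0 n : nat) : nat -> nat -> nat :=
  match n with
  | 0 => hyper 1
  | m.+1 => if m is 0 then hyper 2
            else fun a b => E w0 (F w0 m (L w0 a) (L w0 b))
  end.

Arguments F : simpl never.

Lemma E_inj w0 : 1 < w0 -> injective (E w0).
Proof. by move=> hw a b; rewrite /E !hyper3; apply: expnI. Qed.

Lemma EK w0 : 1 < w0 -> cancel (E w0) (L w0).
Proof. by move=> hw a; apply: xget_unique => //= b /(E_inj hw). Qed.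

Lemma num_level w0 n k : level w0 n (num w0 n k).
Proof. by elim: n => [|n IH] //=; exists (num w0 n k). Qed.

Lemma level_num w0 n x : level w0 n x -> exists k, x = num w0 n k.
Proof.
elim: n x => [|n IH] x /=; first by exists x.
by case=> y /IH[k ->] <-; exists k.
Qed.

Lemma level_sub w0 n : level w0 n.+1 `<=` level w0 n.
Proof.
elim: n => [|n IH] x //= [y ly <-]; exists y => //.
exact: IH.
Qed.

Lemma num_inj w0 n : 1 < w0 -> injective (num w0 n).
Proof. by move=> hw; elim: n => [|n IH] //= k l /(E_inj hw)/IH. Qed.

Lemma F_num w0 n k l : 1 < w0 ->
  F w0 n (num w0 n k) (num w0 n l) = num w0 n (k + l).
Proof.
move=> hw; elim: n => [|[|n] IH]; first exact: hyper1.
  by rewrite -[LHS]/(hyper 2 (E w0 k) (E w0 l)) hyper2 /num /E !hyper3 expnD.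
by rewrite -[LHS]/(E w0 (F w0 n.+1 (L w0 _) (L w0 _))) !(EK hw) IH.
Qed.

Lemma FS_num w0 n k l : 1 < w0 ->
  F w0 n.+1 (num w0 n k) (num w0 n l) = num w0 n (k * l).
Proof.
move=> hw; elim: n => [|n IH]; first exact: hyper2.
by rewrite -[LHS]/(E w0 (F w0 n.+1 (L w0 _) (L w0 _))) !(EK hw) IH.
Qed.

Definition levelT (w0 n : nat) := {x : nat | x \in level w0 n}.
HB.instance Definition _ w0 n := Choice.on (levelT w0 n).

Definition numeral (w0 n k : nat) : levelT w0 n :=
  exist _ (num w0 n k) (mem_set (num_level w0 n k)).

Lemma F_closed w0 (hw : 1 < w0) n (x y : levelT w0 n) :
  F w0 n (val x) (val y) \in level w0 n.
Proof.
case: x y => [x /= /set_mem/level_num[k ->]] [y /= /set_mem/level_num[l ->]].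
by rewrite (F_num _ _ _ hw); apply/mem_set/num_level.
Qed.

Lemma FS_closed w0 (hw : 1 < w0) n (x y : levelT w0 n) :
  F w0 n.+1 (val x) (val y) \in level w0 n.
Proof.
case: x y => [x /= /set_mem/level_num[k ->]] [y /= /set_mem/level_num[l ->]].
by rewrite (FS_num _ _ _ hw); apply/mem_set/num_level.
Qed.

(* F n and F n.+1 as binary operations on level n. *)
Definition Fadd w0 (hw : 1 < w0) n (x y : levelT w0 n) : levelT w0 n :=
  exist _ (F w0 n (val x) (val y)) (F_closed hw x y).

Definition Fmul w0 (hw : 1 < w0) n (x y : levelT w0 n) : levelT w0 n :=
  exist _ (F w0 n.+1 (val x) (val y)) (FS_closed hw x y).

Definition rank w0 n (x : levelT w0 n) : nat :=
  xget 0 [set k | num w0 n k = val x].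

Lemma rankK w0 n (x : levelT w0 n) : numeral w0 n (rank x) = x.
Proof.
apply/val_inj; rewrite /= /rank; case: xgetP => //= nx.
by have /set_mem/level_num[k xE] := valP x; case: (nx k).
Qed.

Lemma numeralK w0 (hw : 1 < w0) n : cancel (numeral w0 n) (@rank w0 n).
Proof. by move=> k; apply: (@num_inj w0 n hw); have [] := rankK (numeral w0 n k). Qed.

Lemma rank_inj w0 n : injective (@rank w0 n).
Proof. exact: can_inj (@rankK w0 n). Qed.

Lemma rankD w0 (hw : 1 < w0) n (x y : levelT w0 n) :
  rank (Fadd hw x y) = rank x + rank y.
Proof.
rewrite -[RHS](numeralK hw n); congr rank; apply/val_inj.
by rewrite /= -(F_num _ _ _ hw) -{1}(rankK x) -{1}(rankK y).
Qed.

Lemma rankM w0 (hw : 1 < w0) n (x y : levelT w0 n) :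
  rank (Fmul hw x y) = rank x * rank y.
Proof.
rewrite -[RHS](numeralK hw n); congr rank; apply/val_inj.
by rewrite /= -(FS_num _ _ _ hw) -{1}(rankK x) -{1}(rankK y).
Qed.

Definition oplus w0 (hw : 1 < w0) n (p q : levelT w0 n * levelT w0 n) :=
  (Fadd hw p.1 q.1, Fadd hw p.2 q.2).

Definition otimes w0 (hw : 1 < w0) n (p q : levelT w0 n * levelT w0 n) :=
  (Fadd hw (Fmul hw p.1 q.1) (Fmul hw p.2 q.2),
   Fadd hw (Fmul hw p.2 q.1) (Fmul hw p.1 q.2)).

Definition square w0 (hw : 1 < w0) n : rel (levelT w0 n * levelT w0 n) :=
  fun p q => Fadd hw p.1 q.2 == Fadd hw p.2 q.1.

Definition pair_int w0 n (p : levelT w0 n * levelT w0 n) : int :=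
  ((rank p.1)%:Z - (rank p.2)%:Z)%R.

Lemma squareE w0 (hw : 1 < w0) n p q :
  @square w0 hw n p q = (pair_int p == pair_int q).
Proof.
rewrite /square -(inj_eq (@rank_inj w0 n)) !rankD /pair_int; lia.
Qed.

Lemma square_refl w0 (hw : 1 < w0) n : reflexive (@square w0 hw n).
Proof. by move=> p; rewrite squareE. Qed.

Lemma square_sym w0 (hw : 1 < w0) n : symmetric (@square w0 hw n).
Proof. by move=> p q; rewrite !squareE eq_sym. Qed.

Lemma square_trans w0 (hw : 1 < w0) n : transitive (@square w0 hw n).
Proof. by move=> q p r; rewrite !squareE => /eqP->. Qed.

Canonical square_equiv w0 (hw : 1 < w0) n :=
  EquivRel (@square w0 hw n)
    (@square_refl w0 hw n) (@square_sym w0 hw n) (@square_trans w0 hw n).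

Definition Zn w0 (hw : 1 < w0) n := {eq_quot (@square w0 hw n)}.
HB.instance Definition _ w0 hw n := Choice.on (@Zn w0 hw n).
HB.instance Definition _ w0 hw n := EqQuotient.on (@Zn w0 hw n).

Definition Zadd w0 (hw : 1 < w0) n (x y : Zn hw n) : Zn hw n :=
  \pi_(Zn hw n) (oplus hw (repr x) (repr y)).

Definition Zmul w0 (hw : 1 < w0) n (x y : Zn hw n) : Zn hw n :=
  \pi_(Zn hw n) (otimes hw (repr x) (repr y)).

Definition Znum w0 (hw : 1 < w0) n (k : nat) : Zn hw n :=
  \pi_(Zn hw n) (numeral w0 n k, numeral w0 n 0).

Definition Zint w0 (hw : 1 < w0) n (x : Zn hw n) : int := pair_int (repr x).

Lemma pair_intD w0 (hw : 1 < w0) n (p q : levelT w0 n * levelT w0 n) :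
  pair_int (oplus hw p q) = (pair_int p + pair_int q)%R.
Proof. by rewrite /pair_int /= !rankD !PoszD; ring. Qed.

Lemma pair_intM w0 (hw : 1 < w0) n (p q : levelT w0 n * levelT w0 n) :
  pair_int (otimes hw p q) = (pair_int p * pair_int q)%R.
Proof. by rewrite /pair_int /= !rankD !rankM !PoszD !PoszM; ring. Qed.

Lemma Zint_pi w0 (hw : 1 < w0) n p : Zint (\pi_(Zn hw n) p) = pair_int p.
Proof. by apply/eqP; rewrite -(squareE hw) -(@eqquotE _ _ (Zn hw n)) reprK. Qed.

Lemma Zint_inj w0 (hw : 1 < w0) n : injective (@Zint w0 hw n).
Proof.
move=> x y; rewrite -[x]reprK -[y]reprK !Zint_pi => e.
by apply/eqP; rewrite eqquotE /= squareE e.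
Qed.

Lemma ZintD w0 (hw : 1 < w0) n (x y : Zn hw n) :
  Zint (Zadd x y) = (Zint x + Zint y)%R.
Proof. by rewrite Zint_pi pair_intD. Qed.

Lemma ZintM w0 (hw : 1 < w0) n (x y : Zn hw n) :
  Zint (Zmul x y) = (Zint x * Zint y)%R.
Proof. by rewrite Zint_pi pair_intM. Qed.

Lemma Zint_num w0 (hw : 1 < w0) n k : Zint (Znum hw n k) = k%:Z%R.
Proof. by rewrite Zint_pi /pair_int /= !(numeralK hw) subr0. Qed.

Lemma Zadd_pi w0 (hw : 1 < w0) n :
  {morph \pi_(Zn hw n) : p q / oplus hw p q >-> Zadd p q}.
Proof. by move=> p q; apply: Zint_inj; rewrite ZintD !Zint_pi pair_intD. Qed.

Lemma Zmul_pi w0 (hw : 1 < w0) n :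
  {morph \pi_(Zn hw n) : p q / otimes hw p q >-> Zmul p q}.
Proof. by move=> p q; apply: Zint_inj; rewrite ZintM !Zint_pi pair_intM. Qed.

Definition Zstar w0 (hw : 1 < w0) n := {x : Zn hw n | x != Znum hw n 0}.
HB.instance Definition _ w0 hw n := Choice.on (@Zstar w0 hw n).

Lemma Zint_eq0 w0 (hw : 1 < w0) n (x : Zn hw n) :
  (x == Znum hw n 0) = (Zint x == 0%R).
Proof. by rewrite -(inj_eq (@Zint_inj w0 hw n)) Zint_num. Qed.

Lemma Zstar_neq0 w0 (hw : 1 < w0) n (x : Zstar hw n) :
  Zint (val x) != 0%R.
Proof. by rewrite -Zint_eq0; exact: (valP x). Qed.

Lemma Zstar_closed w0 (hw : 1 < w0) n (x y : Zstar hw n) :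
  Zmul (val x) (val y) != Znum hw n 0.
Proof. by rewrite Zint_eq0 ZintM mulf_neq0 ?Zstar_neq0. Qed.

Definition Zstar_mul w0 (hw : 1 < w0) n (x y : Zstar hw n) : Zstar hw n :=
  exist _ (Zmul (val x) (val y)) (Zstar_closed x y).

Definition otimes' w0 (hw : 1 < w0) n (p q : Zn hw n * Zstar hw n) :=
  (Zmul p.1 q.1, Zstar_mul p.2 q.2).

Definition oplus' w0 (hw : 1 < w0) n (p q : Zn hw n * Zstar hw n) :=
  (Zadd (Zmul p.1 (val q.2)) (Zmul (val p.2) q.1), Zstar_mul p.2 q.2).

Definition boxtimes w0 (hw : 1 < w0) n : rel (Zn hw n * Zstar hw n) :=
  fun p q => Zmul p.1 (val q.2) == Zmul q.1 (val p.2).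

Definition pair_rat w0 (hw : 1 < w0) n (p : Zn hw n * Zstar hw n) : rat :=
  ((Zint p.1)%:Q / (Zint (val p.2))%:Q)%R.

Lemma Zstar_ratr w0 (hw : 1 < w0) n (x : Zstar hw n) :
  ((Zint (val x))%:Q != 0)%R.
Proof. by rewrite intr_eq0 Zstar_neq0. Qed.

Lemma boxtimesE w0 (hw : 1 < w0) n p q :
  @boxtimes w0 hw n p q = (pair_rat p == pair_rat q).
Proof.
rewrite /boxtimes /pair_rat eqr_div ?Zstar_ratr // -!intrM eqr_int.
by rewrite -(inj_eq (@Zint_inj w0 hw n)) !ZintM.
Qed.

Lemma boxtimes_refl w0 (hw : 1 < w0) n : reflexive (@boxtimes w0 hw n).
Proof. by move=> p; rewrite boxtimesE. Qed.

Lemma boxtimes_sym w0 (hw : 1 < w0) n : symmetric (@boxtimes w0 hw n).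
Proof. by move=> p q; rewrite !boxtimesE eq_sym. Qed.

Lemma boxtimes_trans w0 (hw : 1 < w0) n : transitive (@boxtimes w0 hw n).
Proof. by move=> q p r; rewrite !boxtimesE => /eqP->. Qed.

Canonical boxtimes_equiv w0 (hw : 1 < w0) n :=
  EquivRel (@boxtimes w0 hw n)
    (@boxtimes_refl w0 hw n) (@boxtimes_sym w0 hw n) (@boxtimes_trans w0 hw n).

Definition Qn w0 (hw : 1 < w0) n := {eq_quot (@boxtimes w0 hw n)}.
HB.instance Definition _ w0 hw n := Choice.on (@Qn w0 hw n).
HB.instance Definition _ w0 hw n := EqQuotient.on (@Qn w0 hw n).

Definition Qadd w0 (hw : 1 < w0) n (x y : Qn hw n) : Qn hw n :=
  \pi_(Qn hw n) (oplus' (repr x) (repr y)).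

Definition Qmul w0 (hw : 1 < w0) n (x y : Qn hw n) : Qn hw n :=
  \pi_(Qn hw n) (otimes' (repr x) (repr y)).

Lemma pair_ratD w0 (hw : 1 < w0) n (p q : Zn hw n * Zstar hw n) :
  pair_rat (oplus' p q) = (pair_rat p + pair_rat q)%R.
Proof.
rewrite /pair_rat /= ZintD !ZintM intrD !intrM addf_div ?Zstar_ratr //.
by rewrite [X in (_ + X)%R]mulrC.
Qed.

Lemma pair_ratM w0 (hw : 1 < w0) n (p q : Zn hw n * Zstar hw n) :
  pair_rat (otimes' p q) = (pair_rat p * pair_rat q)%R.
Proof. by rewrite /pair_rat /= !ZintM !intrM mulf_div. Qed.

Lemma pair_rat_repr w0 (hw : 1 < w0) n p :
  pair_rat (repr (\pi_(Qn hw n) p)) = pair_rat p.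
Proof. by apply/eqP; rewrite -boxtimesE -(@eqquotE _ _ (Qn hw n)) reprK. Qed.

Lemma Qadd_pi w0 (hw : 1 < w0) n :
  {morph \pi_(Qn hw n) : p q / oplus' p q >-> Qadd p q}.
Proof.
move=> p q; apply/eqP; rewrite eqquotE /= boxtimesE !pair_ratD.
by rewrite !pair_rat_repr.
Qed.

Lemma Qmul_pi w0 (hw : 1 < w0) n :
  {morph \pi_(Qn hw n) : p q / otimes' p q >-> Qmul p q}.
Proof.
move=> p q; apply/eqP; rewrite eqquotE /= boxtimesE !pair_ratM.
by rewrite !pair_rat_repr.
Qed.

(* (T, add, mul) is a commutative field: T carries a fieldType structure
   whose addition and multiplication are add and mul. *)
Definition is_comm_field (T : Type) (add mul : T -> T -> T) : Prop :=
  exists c : GRing.Field T,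
    let K := GRing.Field.Pack c in
    (forall x y : K, (x + y)%R = add x y) /\
    (forall x y : K, (x * y)%R = mul x y).

(* Main.v *)
(** Reading a level-n number as its rank k, each construction commutes with the
    corresponding one on ordinary numbers, so [pair_rat] induces a bijection
    from Q_n onto the rationals that turns [Qadd] and [Qmul] into + and *; the
    field structure of [rat] is carried back along it. *)
From HB Require Import structures.
Require Import Defs.
From mathcomp Require Import all_boot all_algebra.

Set Implicit Arguments.
Unset Strict Implicit.
Unset Printing Implicit Defensive.

Import GRing.Theory.

Local Open Scope ring_scope.
Local Open Scope quotient_scope.

(** An alias of [T] that carries the bijection and both cancellation proofs as parameters, so that
    instances declared on it can depend on them. *)
Definition transported (T : choiceType) (K : fieldType) (f : T -> K)
  (g : K -> T) (fK : cancel f g) (gK : cancel g f) : Type := T.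

Section Transport.

Context (T : choiceType) (K : fieldType) (f : T -> K) (g : K -> T).
Context (fK : cancel f g) (gK : cancel g f).

Local Notation U := (transported fK gK).

HB.instance Definition _ := Choice.copy U T.

Let zero : U := g 0.
Let one : U := g 1.
Let opp (x : U) : U := g (- f x).
Let add (x y : U) : U := g (f x + f y).
Let mul (x y : U) : U := g (f x * f y).
Let inv (x : U) : U := g (f x)^-1.

Let addA : associative add.
Proof. by move=> x y z; rewrite /add !gK addrA. Qed.

Let addC : commutative add.
Proof. by move=> x y; rewrite /add addrC. Qed.

Let add0 : left_id zero add.
Proof. by move=> x; rewrite /add gK add0r fK. Qed.

Let addN : left_inverse zero opp add.
Proof. by move=> x; rewrite /add gK addNr. Qed.

HB.instance Definition _ := GRing.isZmodule.Build U addA addC add0 addN.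

Let mulA : associative mul.
Proof. by move=> x y z; rewrite /mul !gK mulrA. Qed.

Let mulC : commutative mul.
Proof. by move=> x y; rewrite /mul mulrC. Qed.

Let mul1 : left_id one mul.
Proof. by move=> x; rewrite /mul gK mul1r fK. Qed.

Let mulD : left_distributive mul add.
Proof. by move=> x y z; rewrite /mul /add !gK mulrDl. Qed.

Let one_neq0 : one != zero.
Proof. by rewrite (can_eq gK) oner_neq0. Qed.

HB.instance Definition _ :=
  GRing.Zmodule_isComNzRing.Build U mulA mulC mul1 mulD one_neq0.

Let mulV (x : U) : x != 0 -> mul (inv x) x = one.
Proof. by rewrite -(can_eq fK) gK => x0; rewrite /mul gK mulVf. Qed.

(** The inverse is a total function; its default value at 0 is inherited from [K]. *)
Let inv0 : inv 0 = 0.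
Proof. by rewrite /inv gK invr0. Qed.

HB.instance Definition _ := GRing.ComNzRing_isField.Build U mulV inv0.

(** As [f] is injective, an operation that it turns into + or * must agree with the one pulled back
    through [g]. *)
Lemma is_comm_field_transport (addT mulT : T -> T -> T) :
  {morph f : x y / addT x y >-> x + y} ->
  {morph f : x y / mulT x y >-> x * y} ->
  is_comm_field addT mulT.
Proof.
move=> fD fM; exists (GRing.Field.class U); split=> x y; apply: (can_inj fK).
  by rewrite fD [LHS]gK.
by rewrite fM [LHS]gK.
Qed.

End Transport.

(** The choice of representative is immaterial: [pair_rat] is constant on each class. *)
Definition Qrat w0 (hw : (1 < w0)%N) n (x : Qn hw n) : rat := pair_rat (repr x).

Lemma QratD w0 (hw : (1 < w0)%N) n :
  {morph @Qrat w0 hw n : x y / Qadd x y >-> x + y}.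
Proof. by move=> x y; rewrite /Qrat pair_rat_repr pair_ratD. Qed.

Lemma QratM w0 (hw : (1 < w0)%N) n :
  {morph @Qrat w0 hw n : x y / Qmul x y >-> x * y}.
Proof. by move=> x y; rewrite /Qrat pair_rat_repr pair_ratM. Qed.

Lemma Qrat_inj w0 (hw : (1 < w0)%N) n : injective (@Qrat w0 hw n).
Proof.
move=> x y exy; rewrite -[x]reprK -[y]reprK; apply/eqP.
by rewrite eqquotE /= boxtimesE; apply/eqP.
Qed.

Lemma Zint_surj w0 (hw : (1 < w0)%N) n (z : int) :
  exists x : Zn hw n, Zint x = z.
Proof.
case: z => k; first by exists (Znum hw n k); rewrite Zint_num.
(* [Negz k] stands for -(k+1), hence the successor. *)
exists (\pi_(Zn hw n) (numeral w0 n 0, numeral w0 n k.+1)).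
by rewrite Zint_pi /pair_int /= !(numeralK hw) sub0r NegzE.
Qed.

(** The preimage is the class of the reduced fraction of [q]. The boolean equality lets [xchoose]
    extract a preimage. *)
Lemma Qrat_surj w0 (hw : (1 < w0)%N) n (q : rat) :
  exists x : Qn hw n, Qrat x == q.
Proof.
have [a aE] := Zint_surj hw n (numq q); have [b bE] := Zint_surj hw n (denq q).
have b0 : b != Znum hw n 0 by rewrite Zint_eq0 bE denq_neq0.
exists (\pi_(Qn hw n) (a, exist _ b b0)).
by rewrite /Qrat pair_rat_repr /pair_rat /= aE bE divq_num_den.
Qed.

Theorem theorem4 (w0 : nat) (hw : (1 < w0)%N) (n : nat) :
  is_comm_field (@Qadd w0 hw n) (@Qmul w0 hw n).
Proof.
pose g q := xchoose (Qrat_surj hw n q).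
have gK : cancel g (@Qrat w0 hw n) by move=> q; exact/eqP/(xchooseP (Qrat_surj hw n q)).
(* A right inverse of an injective map is also a left inverse. *)
have fK := inj_can_sym gK (@Qrat_inj w0 hw n).
exact: (is_comm_field_transport fK gK (@QratD w0 hw n) (@QratM w0 hw n)).
Qed.
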